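(* Let $K,F,Z$ be positive integers with $0<Z<F$. If there exists a $(K,F,Z,S)$ PDA, then $$S\geq \left\lceil\frac{(F-Z)K}{F}\right\rceil+\left\lceil\frac{F-Z-1}{F-1}\left\lceil\frac{(F-Z)K}{F}\right\rceil\right\rceil+\cdots+\left\lceil\frac{1}{Z+1}\left\lceil\frac{2}{Z+2}\left\lceil\cdots\left\lceil\frac{(F-Z)K}{F}\right\rceil\cdots\right\rceil\right\rceil\right\rceil,$$ that is, $S\geq\sum_{i=0}^{F-Z-1}x_i$, where $x_0=\left\lceil\frac{(F-Z)K}{F}\right\rceil$ and $x_i=\left\lceil\frac{F-Z-i}{F-i}\,x_{i-1}\right\rceil$ for $1\leq i\leq F-Z-1$.
   Context: Write $[0,b)=\{0,1,\ldots,b-1\}$. For positive integers $K,F$, a $(K,F,S)$ placement delivery array (PDA) is an $F\times K$ array $\mathbf{P}=(p_{i,j})$, $i\in[0,F)$, $j\in[0,K)$, each of whose entries is either the symbol $*$ (''star'') or an integer from $[0,S)$, such that: whenever two distinct entries satisfy $p_{i_1,j_1}=p_{i_2,j_2}=s$ with $s$ an integer, then (a) $i_1\neq i_2$ and $j_1\neq j_2$, and (b) $p_{i_1,j_2}=p_{i_2,j_1}=*$. A $(K,F,Z,S)$ PDA is a $(K,F,S)$ PDA in which each column has exactly $Z$ stars. *)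

(* Defs.v *)
From mathcomp Require Import all_boot all_order all_algebra.
Set Implicit Arguments.
Unset Strict Implicit.
Unset Printing Implicit Defensive.
Import Order.TTheory GRing.Theory Num.Theory.

(* Placement delivery arrays: the star is encoded as [None], the integer
   [s] of [0, S) as [Some s] with [s : 'I_S]. *)

Definition is_pda (K F S : nat) (P : 'M[option 'I_S]_(F, K)) : Prop :=
  forall (i1 i2 : 'I_F) (j1 j2 : 'I_K) (s : 'I_S),
    (i1, j1) <> (i2, j2) -> P i1 j1 = Some s -> P i2 j2 = Some s ->
    (i1 <> i2 /\ j1 <> j2) /\ (P i1 j2 = None /\ P i2 j1 = None).

Definition is_pdaZ (K F Z S : nat) (P : 'M[option 'I_S]_(F, K)) : Prop :=
  is_pda P /\ forall j : 'I_K, #|[set i : 'I_F | P i j == None]| = Z.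

Local Open Scope ring_scope.

(* All subtractions and divisions are in [rat]; the values are meaningful
   for [i < F - Z], where every denominator is positive. *)
Fixpoint pda_term (K F Z i : nat) : int :=
  match i with
  | 0%N => Num.ceil ((F%:R - Z%:R) * K%:R / F%:R : rat)
  | i'.+1 => Num.ceil ((F%:R - Z%:R - i%:R) / (F%:R - i%:R)
                         * (pda_term K F Z i')%:~R : rat)
  end.

(* Main.v *)
(** Pick a row with at least the average number of integers, i.e. at least
    [x_0] of them; they are pairwise distinct.  Keep only the columns where this
    row is an integer and delete the row: by the condition on stars none of its
    symbols occurs in what remains, while each remaining column still has [Z]
    stars.  Iterating with [F - 1], [F - 2], ... rows uses up [x_0], [x_1], ...
    new symbols. *)
Require Import Defs.
From mathcomp Require Import all_boot all_order all_algebra.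
Import Order.TTheory GRing.Theory Num.Theory.
Local Open Scope ring_scope.

(** A maximiser of [f] on [A] works; stating the average multiplied by [#|A|] keeps everything in
    [nat]. *)
Lemma exists_ge_average (T : finType) (A : {set T}) (f : T -> nat) :
  (0 < #|A|)%N ->
  exists2 r, r \in A & (\sum_(i in A) f i <= #|A| * f r)%N.
Proof.
case/card_gt0P=> i0 Ai0; case: (arg_maxnP f Ai0) => r Ar fmax.
by exists r => //; rewrite -sum_nat_const; apply: leq_sum.
Qed.

(** Subarrays are index sets [A] and [B] over a fixed [P], so deleting rows or columns needs no
    reindexing. *)
Definition symbols (K F S : nat) (P : 'M[option 'I_S]_(F, K))
    (A : {set 'I_F}) (B : {set 'I_K}) : {set 'I_S} :=
  [set s | [exists i in A, exists j in B, P i j == Some s]].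

Lemma symbolsP (K F S : nat) (P : 'M[option 'I_S]_(F, K))
    (A : {set 'I_F}) (B : {set 'I_K}) (s : 'I_S) :
  reflect (exists i j, [/\ i \in A, j \in B & P i j = Some s])
          (s \in symbols K F S P A B).
Proof.
rewrite inE; apply: (iffP exists_inP) => [[i Ai /exists_inP[j Bj /eqP Ps]]|].
  by exists i, j.
by move=> [i [j [Ai Bj Ps]]]; exists i => //; apply/exists_inP; exists j; last apply/eqP.
Qed.

Lemma card_symbols_row (K F S : nat) (P : 'M[option 'I_S]_(F, K))
    (A : {set 'I_F}) (B : {set 'I_K}) (r : 'I_F) :
  is_pda P -> r \in A ->
  let C := [set j in B | P r j != None] in
  (#|C| + #|symbols K F S P (A :\ r) C| <= #|symbols K F S P A B|)%N.
Proof.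
move=> pdaP Ar; set C := [set j in B | P r j != None]; rewrite /=.
have PC j : j \in C -> exists s, P r j = Some s.
  by rewrite inE => /andP[_]; case: (P r j) => // s _; exists s.
have cardC : #|C| = #|[set P r j | j in C]|.
  rewrite card_in_imset // => j1 j2 /PC[s Ps] _ eqP12; apply/eqP/negPn/negP => /eqP neq.
  have neq' : (r, j1) <> (r, j2) by case.
  by have [[]] := pdaP _ _ _ _ _ neq' Ps (etrans (esym eqP12) Ps).
have rowE : [set P r j | j in C] = [set Some s | s in symbols K F S P [set r] C].
  apply/setP=> o; apply/imsetP/imsetP.
    case=> j Cj ->; have [s Ps] := PC j Cj; exists s => //.
    by apply/symbolsP; exists r, j; rewrite set11.
  by case=> s /symbolsP[i [j [/set1P-> Cj Ps]]] ->; exists j.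
rewrite cardC rowE card_imset; last by move=> s t [].
(* A symbol at both [(r, j1)] and [(i2, j2)] would force a star at [(r, j2)], but [j2] lies in
   [C]. *)
have dis : symbols K F S P [set r] C :&: symbols K F S P (A :\ r) C = set0.
  apply/setP=> s; rewrite in_set0; apply/negP => /setIP[].
  case/symbolsP=> i1 [j1 [/set1P-> _ P1]] /symbolsP[i2 [j2 [/setD1P[neq _] Cj2 P2]]].
  have [|_ [Pr _]] := pdaP r i2 j1 j2 s _ P1 P2.
    by case=> /eqP; rewrite eq_sym (negPf neq).
  by have [t] := PC j2 Cj2; rewrite Pr.
rewrite -cardsUI dis cards0 addn0; apply/subset_leq_card/subsetP => s.
rewrite inE => /orP[] /symbolsP[i [j [Ai]]]; rewrite inE => /andP[Bj _] Ps;
  apply/symbolsP; exists i, j; split=> //.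
  by move/set1P: Ai => ->.
by case/setD1P: Ai.
Qed.

(** Columns are measured by their integers, not their stars: the deleted row has an integer in every
    kept column, so the count drops by exactly one. *)
Lemma pda_remove_row (K F S : nat) (P : 'M[option 'I_S]_(F, K))
    (A : {set 'I_F}) (B : {set 'I_K}) (d : nat) :
  is_pda P -> (0 < #|A|)%N ->
  (forall j, j \in B -> #|[set i in A | P i j != None]| = d.+1) ->
  exists (A' : {set 'I_F}) (C : {set 'I_K}),
    [/\ #|A| = #|A'|.+1, (d.+1 * #|B| <= #|A| * #|C|)%N,
        forall j, j \in C -> #|[set i in A' | P i j != None]| = d
      & (#|C| + #|symbols K F S P A' C| <= #|symbols K F S P A B|)%N].
Proof.
move=> pdaP A_gt0 colB.
have [r Ar avg] := exists_ge_average _ A (fun i => #|[set j in B | P i j != None]|) A_gt0.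
exists (A :\ r), [set j in B | P r j != None]; split.
- by rewrite (cardsD1 r A) Ar.
(* Double counting of the integer cells of the block [A] by [B], by columns and by rows. *)
- apply: leq_trans avg; rewrite mulnC -sum_nat_const.
  under eq_bigr => j Bj do rewrite -(colB j Bj) -sum1dep_card big_mkcondr.
  under [X in (_ <= X)%N]eq_bigr => i _ do rewrite -sum1dep_card big_mkcondr.
  by rewrite exchange_big.
- move=> j; rewrite inE => /andP[Bj Prj]; apply: succn_inj; rewrite -(colB j Bj).
  rewrite [RHS](cardsD1 r) inE Ar Prj /= add1n; congr _.+1.
  by apply: eq_card => i; rewrite !inE andbA.
exact: card_symbols_row.
Qed.

(* [y_(n+1) = x_n] and [y_0 = K], so that one recurrence covers all terms. *)
Definition pda_width (K F Z n : nat) : int :=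
  if n is m.+1 then pda_term K F Z m else K%:Z.

Lemma pda_widthS (K F Z n : nat) :
  pda_width K F Z n.+1 =
  Num.ceil ((F%:R - Z%:R - n%:R) / (F%:R - n%:R) * (pda_width K F Z n)%:~R : rat).
Proof. by case: n => [|n] //=; rewrite !subr0 mulrAC. Qed.

(** A ceiling is at most the integer [c] as soon as its argument is, so the rounding costs nothing.
    The hypothesis [n < F - Z] makes the truncated subtractions agree with those in [rat]. *)
Lemma pda_widthS_le (K F Z n b c : nat) :
  (n < F - Z)%N -> pda_width K F Z n <= b%:Z ->
  ((F - Z - n) * b <= (F - n) * c)%N -> pda_width K F Z n.+1 <= c%:Z.
Proof.
move=> ltn leb lec.
have ltFn : (n < F)%N by apply: leq_trans ltn (leq_subr _ _).
have leZF : (Z <= F)%N by rewrite ltnW // -subn_gt0 (leq_ltn_trans _ ltn).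
rewrite pda_widthS ceil_le_int -!natrB ?(ltnW ltn) ?(ltnW ltFn) //.
have pos : 0 < (F - n)%:R :> rat by rewrite ltr0n subn_gt0.
rewrite mulrAC ler_pdivrMr // [leRHS]mulrC.
apply: (@le_trans _ _ ((F - Z - n)%:R * b%:R)).
  by apply: ler_wpM2l; rewrite ?ler0n // -[b%:R]/(b%:Z%:~R) ler_int.
by rewrite -[c%:Z%:~R]/(c%:R) -!natrM ler_nat.
Qed.

(** Invariant after [n] deletions. The symbols left in the block stay in the bound, since the next
    term is paid for out of them. *)
Lemma pda_peel (K F Z S : nat) (P : 'M[option 'I_S]_(F, K)) (n : nat) :
  is_pdaZ Z P -> (n <= F - Z)%N ->
  exists (A : {set 'I_F}) (B : {set 'I_K}),
    [/\ #|A| = (F - n)%N, pda_width K F Z n <= #|B|%:Z,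
        forall j, j \in B -> #|[set i in A | P i j != None]| = (F - Z - n)%N
      & \sum_(0 <= i < n) pda_term K F Z i + #|symbols K F S P A B|%:Z <= S%:Z].
Proof.
case=> pdaP starsP; elim: n => [_|n IHn ltn].
  exists setT, setT; split.
  - by rewrite cardsT card_ord subn0.
  - by rewrite cardsT card_ord.
  - move=> j _; rewrite subn0 -(starsP j).
    rewrite cardsCs card_ord; congr (_ - _)%N.
    by apply: eq_card => i; rewrite !inE negbK.
  by rewrite big_geq // add0r lez_nat -[leqRHS]card_ord max_card.
have [A [B [cardA leB colB sumB]]] := IHn (ltnW ltn).
have A_gt0 : (0 < #|A|)%N.
  by rewrite cardA subn_gt0 (leq_trans ltn) ?leq_subr.
have [|A' [C [cardA' leC colC symC]]] := pda_remove_row _ _ _ _ A B (F - Z - n.+1) pdaP A_gt0.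
  by move=> j /colB->; rewrite subnSK.
(* Here [d.+1] is [F - Z - n] and [#|A|] is [F - n], the two parts of the fraction defining the next
   term. *)
have leC' : pda_width K F Z n.+1 <= #|C|%:Z.
  by apply: pda_widthS_le leB _ => //; rewrite -cardA -subnSK.
exists A', C; split=> //.
  by rewrite subnS -cardA cardA'.
rewrite big_nat_recr //= -addrA; apply: le_trans sumB.
by rewrite lerD2l; apply: le_trans (lerD leC' (lexx _)) _; rewrite -PoszD lez_nat.
Qed.

Theorem theorem5 (K F Z S : nat)
  (K_gt0 : (0 < K)%N) (F_gt0 : (0 < F)%N) (Z_gt0 : (0 < Z)%N) (Z_ltF : (Z < F)%N)
  (pda_exists : exists P : 'M[option 'I_S]_(F, K), is_pdaZ Z P) :
  \sum_(0 <= i < F - Z) pda_term K F Z i <= S%:Z.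
Proof.
have [P pdaP] := pda_exists.
have [A [B [_ _ _]]] := pda_peel _ _ _ _ _ _ pdaP (leqnn (F - Z)).
by apply: le_trans; rewrite lerDl.
Qed.
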